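(* Let $K\ge 2$, $\mathbf C\in\mathbb R^{K\times R}$ and $k_{\mathbf C}=K$. Then (i) $\mathcal B(\mathbf C)$ has no proportional columns, that is, $k_{\mathcal B(\mathbf C)}\ge 2$; (ii) for $m:=R-K+2$, the matrices $$\mathcal B(\mathbf C)^{(m-1)}=\underbrace{\mathcal B(\mathbf C)\odot\dots\odot\mathcal B(\mathbf C)}_{m-1},\qquad \mathcal B(\mathbf C)^{(m)}=\underbrace{\mathcal B(\mathbf C)\odot\dots\odot\mathcal B(\mathbf C)}_{m}$$ have full column rank.
   Context: $k_{\mathbf M}$ (the $k$-rank of a matrix $\mathbf M$) is the largest number such that every subset of $k_{\mathbf M}$ columns of $\mathbf M$ is linearly independent (so $k_{\mathbf C}=K$ implies $K\le R$). For $k\le\min(p,q)$, the $k$-th compound matrix $\mathcal C_k(\mathbf M)$ of $\mathbf M\in\mathbb R^{p\times q}$ is the $\binom pk\times\binom qk$ matrix of all $k\times k$ minors of $\mathbf M$, with row and column index sets in lexicographic order. For $\mathbf C\in\mathbb R^{K\times R}$, $\mathcal B(\mathbf C):=\mathbf L\,\mathcal C_{K-1}(\mathbf C)\in\mathbb R^{K\times\binom{R}{K-1}}$, where $\mathbf L\in\mathbb R^{K\times K}$ is the anti-diagonal matrix with entries $\mathbf L_{K+1-j,\,j}=(-1)^{j-1}$, $1\le j\le K$, and zeros elsewhere. $\odot$ is the Khatri-Rao (column-wise Kronecker) product: $\mathbf X\odot\mathbf Y=[\mathbf x_1\otimes\mathbf y_1\ \cdots\ \mathbf x_N\otimes\mathbf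 y_N]$. A matrix with $N$ columns has full column rank if its rank is $N$. *)

(* Defs.v *)
From HB Require Import structures.
From mathcomp Require Import all_boot all_order all_algebra.
From mathcomp Require Import mxtens reals.

Set Implicit Arguments.
Unset Strict Implicit.
Unset Printing Implicit Defensive.

Import Order.TTheory GRing.Theory Num.Theory.
Local Open Scope ring_scope.

(* Columns are distinguished by their index, so a matrix with two equal columns
   has k-rank at most 1. Since [k <= q], the maximum ignores the sizes [k > q],
   for which there is no subset of [k] columns. *)
Definition krank (F : fieldType) (p q : nat) (M : 'M[F]_(p, q)) : nat :=
  (\max_(k < q.+1 | [forall J : {set 'I_q}, (#|J| == k) ==>
      row_free (colsub (fun j : 'I_#|J| => enum_val j) M)^T]) k)%N.

(* A k-element subset of 'I_n is encoded as a strictly increasing k-tuple. *)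
Definition incr_tuples (n k : nat) : {set k.-tuplelexi 'I_n} :=
  [set t : k.-tuple 'I_n | sorted ltn (map val t)].

Lemma card_incr_tuples (n k : nat) : #|incr_tuples n k| = 'C(n, k).
Proof. exact: card_ltn_sorted_tuples. Qed.

(* [Order.enum_val], unlike [enum_val], is increasing, so this enumerates the
   k-element subsets of 'I_n in lexicographic order. *)
Definition lex_subset (n k : nat) (I : 'I_'C(n, k)) : k.-tuplelexi 'I_n :=
  Order.enum_val (cast_ord (esym (card_incr_tuples n k)) I).

Lemma le_lex_subset (n k : nat) :
  {mono @lex_subset n k : I J / (I <= J)%O >-> (I <= J)%O}.
Proof. by move=> I J; rewrite (Order.le_enum_val le_total). Qed.

Definition compound (A : pzRingType) (p q k : nat) (M : 'M[A]_(p, q)) :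
    'M[A]_('C(p, k), 'C(q, k)) :=
  \matrix_(I, J) \det (mxsub (tnth (lex_subset I)) (tnth (lex_subset J)) M).

Definition signed_antidiag (A : pzRingType) (K : nat) : 'M[A]_K :=
  \matrix_(i, j) (if i == rev_ord j then (-1) ^+ j else 0).

Lemma bin_predn (K : nat) : (0 < K)%N -> 'C(K, K.-1) = K.
Proof. by case: K => // K _; rewrite binSn. Qed.

Definition calB (A : pzRingType) (K N : nat) (K_gt0 : (0 < K)%N)
    (C : 'M[A]_(K, N)) : 'M[A]_(K, 'C(N, K.-1)) :=
  signed_antidiag A K *m castmx (bin_predn K_gt0, erefl) (compound K.-1 C).

Definition khatri_rao (A : pzRingType) (p q N : nat)
    (X : 'M[A]_(p, N)) (Y : 'M[A]_(q, N)) : 'M[A]_(p * q, N) :=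
  \matrix_(i, j) tensmx (col j X) (col j Y) i ord0.

(* Two-step definition, as for [ntensmx], because [p ^ k.+2] is convertible to
   [p * p ^ k.+1] whereas [p ^ k.+1] is not convertible to [p * p ^ k]. *)
Fixpoint khatri_rao_powS (A : pzRingType) (p N : nat) (X : 'M[A]_(p, N))
    (k : nat) : 'M[A]_(p ^ k.+1, N) :=
  if k is k'.+1 then khatri_rao X (khatri_rao_powS X k') else X.

(* [k] is the number of factors; the empty product is a row of ones. *)
Definition khatri_rao_pow (A : pzRingType) (p N : nat) (X : 'M[A]_(p, N))
    (k : nat) : 'M[A]_(p ^ k, N) :=
  if k is k'.+1 return 'M[A]_(p ^ k, N) then khatri_rao_powS X k'
  else const_mx 1.

Definition full_column_rank (F : fieldType) (p N : nat) (M : 'M[F]_(p, N)) :=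
  \rank M = N.

(* Main.v *)
Require Import Defs.
From mathcomp Require Import all_boot all_order all_algebra.
From mathcomp Require Import mxtens reals.
From mathcomp Require Import zify.

Set Implicit Arguments.
Unset Strict Implicit.
Unset Printing Implicit Defensive.

Import Order.TTheory GRing.Theory Num.Theory.
Local Open Scope ring_scope.

(** Write b_J for the column of B = calB C indexed by the (K-1)-subset J, and c_i
    for the columns of C.  The signs and the order reversal in the definition of
    B are such that the entries of b_J are, up to a common sign, the cofactors of
    the first column of the matrix [x | C_J].  Laplace expansion then gives
    <c_i, b_J> = +- det [c_i | C_J] (calB_dot).  This determinant has a repeated
    column if i belongs to J, and has K distinct columns of C otherwise; since
    the k-rank of C is K, we get <c_i, b_J> <> 0 iff i is not in J
    (calB_dot_neq0).  So the columns of C, used as linear forms, test membership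
    in the index sets of the columns of B, and the rest is combinatorics.

    Two columns b_J and b_L with J <> L are independent, because some c_i with i
    in L but not in J kills b_L and not b_J, and symmetrically (krank_calB).

    For the Khatri-Rao powers, let k >= N - K + 1 = #(complement of J), and list
    the complement of J as i_1, ..., i_k, with repetitions allowed.  The pure
    tensor c_{i_1} (x) ... (x) c_{i_k}, used as a linear form, takes on the k-th
    tensor power of b_L the product of the values <c_{i_s}, b_L>.  It is nonzero
    iff L is disjoint from the complement of J, hence iff L = J, as J and L have
    the same cardinality.  These forms separate the columns of the k-th power,
    which therefore are independent (khatri_rao_pow_calB_rank).  Both exponents
    N - K + 1 and N - K + 2 are covered. *)

(** * Linear forms on the columns of a matrix and of its Khatri-Rao powers *)

(** Stacking the separating forms yields a left factor that turns the matrix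
    into an invertible diagonal one. *)
Lemma separated_columns_rank (F : fieldType) (p n : nat) (M : 'M[F]_(p, n)) :
    (forall j, exists w : 'rV_p, forall k, ((w *m M) 0 k != 0) = (k == j)) ->
  \rank M = n.
Proof.
move=> /fin_all_exists [w Hw].
pose W := \matrix_j w j.
have WE j k : (W *m M) j k = (w j *m M) 0 k.
  by rewrite -[in RHS](rowK w j) -row_mul [RHS]mxE.
have WM_diag : W *m M = diag_mx (\row_j (w j *m M) 0 j).
  apply/matrixP=> j k; rewrite WE [RHS]mxE [X in X *+ _]mxE.
  have [<-|ne] := eqVneq j k; first by rewrite mulr1n.
  by rewrite mulr0n; apply/eqP/negPn; rewrite Hw eq_sym.
have WM_unit : W *m M \in unitmx.
  rewrite unitmxE WM_diag det_diag unitfE; apply/prodf_neq0 => j _.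
  by rewrite mxE Hw.
apply/eqP; rewrite eqn_leq rank_leq_col /=.
by rewrite -{1}(mxrank_unit WM_unit) mxrankM_maxr.
Qed.

Lemma khatri_rao_functional (F : fieldType) (p q n : nat) (X : 'M[F]_(p, n))
    (Y : 'M_(q, n)) (u : 'rV_p) (v : 'rV_q) (j : 'I_n) :
  (tensmx u v *m khatri_rao X Y : 'rV_n) 0 j = (u *m X) 0 j * (v *m Y) 0 j.
Proof.
rewrite !mxE mulr_sum; apply: eq_bigr => i _.
by rewrite !mxE mulrACA !ord1.
Qed.

(** The form is the pure tensor of the w i: a pure tensor of forms is
    multiplicative on pure tensors of vectors. *)
Lemma khatri_rao_powS_functional (F : fieldType) (p n : nat) (X : 'M[F]_(p, n))
    (k : nat) (w : nat -> 'rV_p) :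
  exists W : 'rV_(p ^ k.+1), forall j,
    (W *m khatri_rao_powS X k) 0 j = \prod_(i < k.+1) (w i *m X) 0 j.
Proof.
elim: k w => [|k IHk] w.
  by exists (w 0); move=> j; rewrite big_ord1.
have [W HW] := IHk (fun i => w i.+1).
exists (tensmx (w 0) W) => j.
by rewrite big_ord_recl -HW; apply: khatri_rao_functional.
Qed.

(** * Subsets in lexicographic order *)

Lemma lex_subset_sorted (n k : nat) (J : 'I_'C(n, k)) :
  sorted ltn (map val (lex_subset J : k.-tuple 'I_n)).
Proof.
have := Order.enum_valP (cast_ord (esym (card_incr_tuples n k)) J).
by rewrite inE.
Qed.

Lemma lex_subset_uniq (n k : nat) (J : 'I_'C(n, k)) :
  uniq (lex_subset J : k.-tuple 'I_n).
Proof.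
have /(sorted_uniq ltn_trans ltnn) := lex_subset_sorted J.
by rewrite (map_inj_uniq val_inj).
Qed.

Definition lex_set (n k : nat) (J : 'I_'C(n, k)) : {set 'I_n} :=
  [set i in (lex_subset J : seq 'I_n)].

Lemma card_lex_set (n k : nat) (J : 'I_'C(n, k)) : #|lex_set J| = k.
Proof.
by rewrite cardsE (card_uniqP (lex_subset_uniq J)) size_tuple.
Qed.

Lemma lex_set_inj (n k : nat) : injective (@lex_set n k).
Proof.
move=> I J /setP eqIJ.
apply: (inc_inj (@le_lex_subset n k)); apply: val_inj.
apply: (inj_map val_inj).
apply: (irr_sorted_eq ltn_trans ltnn) => [||i]; try exact: lex_subset_sorted.
apply/mapP/mapP => -[x xI ->]; exists x => //.
  by have := eqIJ x; rewrite !inE xI => /esym.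
by have := eqIJ x; rewrite !inE xI.
Qed.

Lemma lex_set_sub (n k : nat) (I J : 'I_'C(n, k)) :
  lex_set I \subset lex_set J -> I = J.
Proof.
by move=> sIJ; apply/lex_set_inj/eqP; rewrite eqEcard sIJ !card_lex_set leqnn.
Qed.

Definition codim1_tuple (n : nat) (r : 'I_n.+1) : n.-tuplelexi 'I_n.+1 :=
  map_tuple (lift r) (ord_tuple n).

Lemma tnth_codim1_tuple (n : nat) (r : 'I_n.+1) :
  tnth (codim1_tuple r) =1 lift r.
Proof. by move=> i; rewrite tnth_map tnth_ord_tuple. Qed.

Lemma codim1_tuple_incr (n : nat) (r : 'I_n.+1) :
  codim1_tuple r \in incr_tuples n.+1 n.
Proof.
rewrite inE -map_comp sorted_map.
apply: (@sub_sorted _ (relpre val ltn)); last first.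
  by rewrite -sorted_map val_enum_ord iota_ltn_sorted.
by move=> i j; rewrite /= /bump; lia.
Qed.

(** The two enumerations first differ at position r, where the tuple omitting r'
    still has r while the one omitting r already jumps to r + 1. *)
Lemma codim1_tuple_anti (n : nat) (r r' : 'I_n.+1) :
  (r < r')%N -> (codim1_tuple r' < codim1_tuple r)%O.
Proof.
move=> lt_r; have r_n : (r < n)%N by have := ltn_ord r'; lia.
apply/ltxi_tuplePlt; exists (Ordinal r_n) => [i /= lt_i|].
  by rewrite !tnth_codim1_tuple; apply: val_inj; rewrite /= /bump; lia.
by rewrite !tnth_codim1_tuple ltEord /= /bump; lia.
Qed.

(** Omitting the points n, n - 1, ..., 0 in turn lists the n-subsets of n + 1
    points in strictly increasing order, as does lex_subset, and a finite set has
    only one such listing. *)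
Lemma lex_subset_codim1 (n : nat) (s : 'I_'C(n.+1, n)) (r : 'I_n.+1) :
  (s + r = n)%N -> tnth (lex_subset s) =1 lift r.
Proof.
move=> sr i; rewrite -tnth_codim1_tuple; congr (tnth _ i).
pose g (s : 'I_'C(n.+1, n)) := @codim1_tuple n (inord (n - s)).
have g_lt : {homo g : s s' / (s < s')%O}.
  move=> s1 s2; rewrite ltEord => lt12; apply: codim1_tuple_anti.
  have := ltn_ord s2; rewrite [X in (_ < X)%N]binSn => lt2.
  by rewrite !inordK; lia.
have enum_lt : sorted <%O (enum 'I_'C(n.+1, n)).
  by have := iota_ltn_sorted 0 'C(n.+1, n); rewrite -val_enum_ord sorted_map.
have eq_map : map g (enum 'I_'C(n.+1, n)) =
    map (@lex_subset n.+1 n) (enum 'I_'C(n.+1, n)).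
  have g_sorted := homo_sorted g_lt _ enum_lt.
  have lex_sorted : sorted <%O (map (@lex_subset n.+1 n) (enum 'I_'C(n.+1, n))).
    by apply: homo_sorted enum_lt => I J; rewrite (leW_mono (@le_lex_subset _ _)).
  apply: lt_sorted_eq => //.
  refine (uniq_min_size (lt_sorted_uniq g_sorted) _ _).2; last first.
    by rewrite !size_map.
  move=> _ /mapP [s' _ ->].
  have g_in := @codim1_tuple_incr n (inord (n - s')).
  apply/mapP; exists (cast_ord (card_incr_tuples _ _)
    (Order.enum_rank_in g_in (g s'))); first by rewrite mem_enum.
  by rewrite /lex_subset cast_ordK Order.enum_rankK_in.
have /eq_in_map/(_ s (mem_enum _ s)) <- := eq_map.
congr codim1_tuple; apply: val_inj; rewrite /= inordK; lia.
Qed.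

(** * The k-rank *)

Lemma krank_le_cols (F : fieldType) (p q : nat) (M : 'M[F]_(p, q)) :
  (krank M <= q)%N.
Proof. by apply/bigmax_leqP => k _; rewrite -ltnS. Qed.

(** The maximum that defines the k-rank is attained, since size 0 always
    qualifies. *)
Lemma krank_row_free (F : fieldType) (p q : nat) (M : 'M[F]_(p, q))
    (J : {set 'I_q}) :
  #|J| = krank M -> row_free (colsub (fun j : 'I_#|J| => enum_val j) M)^T.
Proof.
move=> cardJ.
suff /forallP/(_ J)/implyP : [forall J : {set 'I_q}, (#|J| == krank M) ==>
    row_free (colsub (fun j : 'I_#|J| => enum_val j) M)^T].
  by apply; apply/eqP.
rewrite /krank; elim/big_ind: _ => // [|k l Hk Hl].
  apply/forallP => J0; rewrite -leqn0; apply/implyP => J0_0.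
  by rewrite /row_free eqn_leq rank_leq_row (leq_trans J0_0).
by rewrite /maxn; case: ifP.
Qed.

(** The columns listed by f span the same space as the columns in the image of f,
    whatever the order of the listing. *)
Lemma krank_det_neq0 (F : fieldType) (K N : nat) (C : 'M[F]_(K, N))
    (f : 'I_K -> 'I_N) :
  krank C = K -> injective f -> \det (colsub f C) != 0.
Proof.
move=> hC f_inj.
pose J := f @: [set: 'I_K].
have cardJ : #|J| = K by rewrite card_imset // cardsT card_ord.
rewrite -unitfE -unitmxE -unitmx_tr -row_free_unit /row_free.
have /eqP rankJ : row_free (colsub (fun j : 'I_#|J| => enum_val j) C)^T.
  by apply: krank_row_free; rewrite cardJ hC.
rewrite eqn_leq rank_leq_row /= -{1}cardJ -rankJ.
apply: mxrankS; apply/row_subP => j.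
have /imsetP [i _ Ei] := enum_valP j.
suff -> : row j (colsub (fun j : 'I_#|J| => enum_val j) C)^T =
    row i (colsub f C)^T by apply: row_sub.
by apply/rowP => r; rewrite !mxE Ei.
Qed.

(** * The columns of calB as vectors of cofactors *)

(** The anti-diagonal factor picks the row of rank n - r in the compound matrix,
    which is the one whose row set omits r. *)
Lemma calB_minor (A : comPzRingType) (n N : nat) (K_gt0 : (0 < n.+1)%N)
    (C : 'M[A]_(n.+1, N)) (r : 'I_n.+1) (J : 'I_'C(N, n)) :
  calB K_gt0 C r J =
    (-1) ^+ rev_ord r * \det (mxsub (lift r) (tnth (lex_subset J)) C).
Proof.
rewrite mxE (bigD1 (rev_ord r)) //= big1 ?addr0 => [|s ne]; last first.
  rewrite mxE ifN ?mul0r //; apply: contraNneq ne => ->; by rewrite rev_ordK.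
rewrite mxE rev_ordK eqxx castmxE mxE cast_ord_id; congr (_ * \det _).
apply/matrixP => i j; rewrite !mxE (@lex_subset_codim1 _ _ r) //=.
by rewrite subSS subnK // -ltnS.
Qed.

(** By calB_minor the left-hand side is, up to sign, the Laplace expansion along
    its first column of the matrix formed by the i-th column of C and the columns
    in J. *)
Lemma calB_dot (A : comNzRingType) (n N : nat) (K_gt0 : (0 < n.+1)%N)
    (C : 'M[A]_(n.+1, N)) (i : 'I_N) (J : 'I_'C(N, n)) :
  ((col i C)^T *m calB K_gt0 C) 0 J =
    (-1) ^+ n * \det (colsub (fun k : 'I_n.+1 =>
       oapp (tnth (lex_subset J)) i (unlift ord0 k)) C).
Proof.
rewrite (expand_det_col _ ord0) mulr_sumr mxE; apply: eq_bigr => r _.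
rewrite calB_minor !mxE unlift_none /= [RHS]mulrCA; congr (_ * _).
rewrite /cofactor addn0 mulrA -exprD; congr (_ * _); last first.
  by congr (\det _); apply/matrixP => a b; rewrite !mxE liftK.
have le_rn : (r <= n)%N by rewrite -ltnS.
(* The sign (-1)^(n-r) of calB_minor is (-1)^n times the cofactor sign (-1)^r. *)
have -> : (n + r = (n - r) + 2 * r)%N by lia.
by rewrite subSS exprD exprM sqrrN !expr1n mulr1.
Qed.

(** For i in J the determinant of calB_dot has two equal columns; for i outside J
    it is a maximal minor of C with distinct columns, nonzero by the k-rank
    hypothesis. *)
Lemma calB_dot_neq0 (F : fieldType) (K N : nat) (K_gt0 : (0 < K)%N)
    (C : 'M[F]_(K, N)) (i : 'I_N) (J : 'I_'C(N, K.-1)) :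
  krank C = K ->
  (((col i C)^T *m calB K_gt0 C) 0 J != 0) = (i \notin lex_set J).
Proof.
case: K K_gt0 C J => // n K_gt0 C J hC.
rewrite calB_dot mulrI_eq0; last exact/lregX/lregN/lreg1.
have [|iJ] := boolP (i \in lex_set J).
  rewrite inE => /tnthP [k Ek]; apply/negbTE; rewrite negbK -det_tr.
  apply/eqP/(@determinant_alternate _ _ _ ord0 (lift ord0 k)) => // r.
  by rewrite !mxE unlift_none liftK /= Ek.
apply: (krank_det_neq0 hC) => a b.
have t_inj : injective (tnth (lex_subset J)).
  exact/tuple_uniqP/lex_subset_uniq.
have iNt k : tnth (lex_subset J) k <> i.
  by move=> Ek; case/negP: iJ; rewrite inE -Ek mem_tnth.
case: (unliftP ord0 a) => [a'|] ->; case: (unliftP ord0 b) => [b'|] -> //=.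
- by move/t_inj ->.
- by move/iNt.
- by move/esym/iNt.
Qed.

(** * Independence of the columns of calB and of its Khatri-Rao powers *)

(** The form separating J is the tensor product of the columns of C indexed by the
    complement of J, which has N - K + 1 elements; surplus factors repeat one of
    them. *)
Lemma khatri_rao_pow_calB_rank (F : fieldType) (K N : nat) (K_gt0 : (0 < K)%N)
    (C : 'M[F]_(K, N)) (k : nat) :
  krank C = K -> (N - K < k)%N ->
  full_column_rank (khatri_rao_pow (calB K_gt0 C) k).
Proof.
move=> hC; case: k => // k le_k; apply: separated_columns_rank => J.
pose s := enum (~: lex_set J).
have size_s : size s = (N - K).+1.
  have := cardsC (lex_set J); rewrite card_lex_set card_ord -cardE.
  have := krank_le_cols C; rewrite hC; lia.
(* i0 is the value of the list beyond its end, hence the repeated factor. *)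
have [i0 i0J] : exists i0, i0 \in ~: lex_set J.
  by apply/card_gt0P; rewrite cardE -/s size_s.
have [W WE] := khatri_rao_powS_functional (calB K_gt0 C) k
  (fun i => (col (nth i0 s i) C)^T).
exists W => J'; rewrite WE; apply/prodf_neq0/eqP => [sep|-> i _]; last first.
  rewrite calB_dot_neq0 // -in_setC -mem_enum -/s.
  have [lt_i|le_i] := ltnP i (size s); first exact: mem_nth.
  by rewrite nth_default // mem_enum.
apply: lex_set_sub; apply/subsetP => i; apply: contraLR => iJ.
have i_s : i \in s by rewrite mem_enum inE.
have lt_i : (index i s < k.+1)%N.
  by apply: leq_trans le_k; rewrite -size_s index_mem.
by have := sep (Ordinal lt_i) isT; rewrite calB_dot_neq0 // nth_index.
Qed.

(** The column b_J of a pair is separated from the other one, b_L, by any column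
    of C whose index is in L but not in J. *)
Lemma krank_calB (F : fieldType) (K N : nat) (K_gt0 : (0 < K)%N)
    (C : 'M[F]_(K, N)) :
  (2 <= K)%N -> krank C = K -> (2 <= krank (calB K_gt0 C))%N.
Proof.
move=> hK hC; have leKN : (K <= N)%N by rewrite -{1}hC krank_le_cols.
have ge2 : (2 < 'C(N, K.-1).+1)%N.
  rewrite ltnS; apply: leq_trans (_ : 'C(K, K.-1) <= _)%N.
    by rewrite bin_predn.
  exact: leq_bin2l.
apply: (leq_bigmax_cond (Ordinal ge2)).
apply/forallP => S; apply/implyP => /= cardS.
rewrite /row_free mxrank_tr; apply/eqP/separated_columns_rank => j.
(* l is the element of the pair S other than the one numbered j. *)
have [l defl] : exists l, S :\ enum_val j = [set l].
  apply/cards1P; have := cardsD1 (enum_val j) S.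
  by rewrite enum_valP (eqP cardS) add1n => -[<-].
have ne_lj : l != enum_val j.
  by have := set11 l; rewrite -defl !inE => /andP [].
have /subsetPn [i il ij] : ~~ (lex_set l \subset lex_set (enum_val j)).
  by apply: contra ne_lj => /lex_set_sub ->.
exists (col i C)^T => k.
rewrite mulmx_colsub mxE calB_dot_neq0 //.
have [->|ne_kj] := eqVneq k j; first exact: ij.
have -> : enum_val k = l.
  by apply/set1P; rewrite -defl !inE enum_valP (inj_eq enum_val_inj) ne_kj.
by rewrite il.
Qed.

Theorem proposition1p10 (R : realType) (K N : nat) (hK : (2 <= K)%N)
    (C : 'M[R]_(K, N)) (hC : krank C = K) :
  let B := calB (ltnW hK) C in
  let m := (N - K + 2)%N in
  (2 <= krank B)%N /\
  full_column_rank (khatri_rao_pow B (m - 1)) /\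
  full_column_rank (khatri_rao_pow B m).
Proof.
move=> B m; split; first exact: krank_calB.
by split; apply: khatri_rao_pow_calB_rank; rewrite // /m; lia.
Qed.
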